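(* Let $\Gamma>1$ be the constant ratio of specific heats. For the special relativistic magnetohydrodynamic system with ideal equation of state, the GQL representation of the invariant region $$G=\big\{\mathbf u=(D,\boldsymbol m,\mathbf B,E)^\top\in\mathbb R^8:\ D>0,\ p(\mathbf u)>0,\ 1-\|\boldsymbol v(\mathbf u)\|>0\big\}$$ is given by $$G_*=\big\{\mathbf u=(D,\boldsymbol m,\mathbf B,E)^\top\in\mathbb R^8:\ D>0,\ \varphi(\mathbf u;\boldsymbol v_*,\mathbf B_* )>0\quad\forall\,\mathbf B_*\in\mathbb R^3,\ \forall\,\boldsymbol v_*\in\mathbb B_1(\mathbf 0)\big\},$$ where $\mathbb B_1(\mathbf 0):=\{\boldsymbol x\in\mathbb R^3:\|\boldsymbol x\|\le 1\}$ is a unit 3D ball and $\varphi(\mathbf u;\boldsymbol v_*,\mathbf B_* ):=\mathbf u\cdot\mathbf n_*+p_m^*$ is linear (affine) in $\mathbf u$, with $$p_m^*:=\tfrac12\Big((1-\|\boldsymbol v_*\|^2)\|\mathbf B_*\|^2+(\boldsymbol v_*\cdot\mathbf B_* )^2\Big),$$ $$\mathbf n_*:=\Big(-\sqrt{1-\|\boldsymbol v_*\|^2},\ -\boldsymbol v_*,\ -(1-\|\boldsymbol v_*\|^2)\mathbf B_*-(\boldsymbol v_*\cdot\mathbf B_* )\boldsymbol v_*,\ 1\Big)^\top;$$ that is, $G=G_*$. Here $p_m^*$ and $\mathbf n_*$ depend only on the free auxiliary variables $(\boldsymbol v_*,\mathbf B_* )$.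
   Context: A GQL (geometric quasilinearization, i.e. equivalent linear) representation of a set is an equal set described by constraints that are all affine in $\mathbf u$, possibly quantified over auxiliary parameters independent of $\mathbf u$. The system is $$\partial_t\begin{pmatrix}D\\ \boldsymbol m\\ \mathbf B\\ E\end{pmatrix}+\nabla\cdot\begin{pmatrix}D\boldsymbol v\\ \boldsymbol m\otimes\boldsymbol v-\mathbf B\otimes(\gamma^{-2}\mathbf B+(\boldsymbol v\cdot\mathbf B)\boldsymbol v)+p_{tot}\mathbf I\\ \boldsymbol v\otimes\mathbf B-\mathbf B\otimes\boldsymbol v\\ \boldsymbol m\end{pmatrix}=\mathbf 0,$$ with $\nabla\cdot\mathbf B=0$; the speed of light is 1, $\boldsymbol m,\mathbf B\in\mathbb R^3$, $D,E\in\mathbb R$. In terms of the rest-mass density $\rho$, velocity $\boldsymbol v$, thermal pressure $p$, magnetic field $\mathbf B$, Lorentz factor $\gamma=(1-\|\boldsymbol v\|^2)^{-1/2}$ and specific enthalpy $h=1+e+p/\rho$, where $e$ is the specific internal energy and $p=(\Gamma-1)\rho e$, one has $$D=\rho\gamma,\quad \boldsymbol m=(\rho h\gamma^2+\|\mathbf B\|^2)\boldsymbol v-(\boldsymbol v\cdot\mathbf B)\mathbf B,\quad E=\rho h\gamma^2-p_{tot}+\|\mathbf B\|^2,$$ $$p_{tot}=p+p_m,\qquad p_m=\tfrac12\big(\gamma^{-2}\|\mathbf B\|^2+(\boldsymbol v\cdot\mathbf B)^2\big).$$ The functions $p(\mathbf u)$ and $\boldsymbol v(\mathbf u)$ are the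 pressure and velocity as (implicit) functions of $\mathbf u$: $$p(\mathbf u)=\frac{\Gamma-1}{\Gamma\Upsilon_{\mathbf u}^2(\hat\phi)}\big(\hat\phi-D\Upsilon_{\mathbf u}(\hat\phi)\big),\qquad \boldsymbol v(\mathbf u)=\frac{\boldsymbol m+(\boldsymbol m\cdot\mathbf B)\mathbf B/\hat\phi}{\hat\phi+\|\mathbf B\|^2},$$ where $$\Upsilon_{\mathbf u}(\phi):=\Big(\frac{\phi^2(\phi+\|\mathbf B\|^2)^2-[\phi^2\|\boldsymbol m\|^2+(2\phi+\|\mathbf B\|^2)(\boldsymbol m\cdot\mathbf B)^2]}{\phi^2(\phi+\|\mathbf B\|^2)^2}\Big)^{-1/2}$$ and $\hat\phi=\hat\phi(\mathbf u)$ is the positive root of $$F(\phi;\mathbf u):=\phi-E+\|\mathbf B\|^2-\frac12\Big(\frac{(\boldsymbol m\cdot\mathbf B)^2}{\phi^2}+\frac{\|\mathbf B\|^2}{\Upsilon_{\mathbf u}^2(\phi)}\Big)+\frac{\Gamma-1}{\Gamma}\Big(\frac{D}{\Upsilon_{\mathbf u}(\phi)}-\frac{\phi}{\Upsilon_{\mathbf u}^2(\phi)}\Big).$$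
   Formalization: The positive root of F(·;u) is assumed unique for every u with D>0. This holds for 1<Γ≤2 and fails for every Γ>2, where G=G_* is itself false (e.g. Γ=3, B=0, |m|=1, D=0.001, E≈0.9433 gives u in G but not in G_* ); so the theorem has content only for 1<Γ≤2. *)

(* Defs.v *)
From HB Require Import structures.
From mathcomp Require Import all_boot all_order all_algebra.
From mathcomp Require Import all_classical all_reals.

Set Implicit Arguments.
Unset Strict Implicit.
Unset Printing Implicit Defensive.

Import Order.TTheory GRing.Theory Num.Theory.
Local Open Scope classical_set_scope.
Local Open Scope ring_scope.

Section Euclidean.
Context {R : realType} {n : nat}.

Definition dot (x y : 'rV[R]_n) : R := \sum_(i < n) x 0 i * y 0 i.

(* The Euclidean norm; the norm `|x| of MathComp-Analysis on 'rV is the sup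
   norm. *)
Definition enorm (x : 'rV[R]_n) : R := Num.sqrt (dot x x).

Definition affine_fun (f : 'rV[R]_n -> R) : Prop :=
  exists (l : {scalar 'rV[R]_n}) (c : R), forall x, f x = l x + c.

End Euclidean.

Section RMHD.
Context {R : realType}.

(* R^8, split as the blocks D, m, B, E. *)
Definition state : Type := 'rV[R]_(1 + 3 + 3 + 1).

Definition mkstate (D : R) (m B : 'rV[R]_3) (E : R) : state :=
  row_mx (row_mx (row_mx D%:M m) B) E%:M.

Definition density (u : state) : R := lsubmx (lsubmx (lsubmx u)) 0 0.
Definition momentum (u : state) : 'rV[R]_3 := rsubmx (lsubmx (lsubmx u)).
Definition magnetic (u : state) : 'rV[R]_3 := rsubmx (lsubmx u).
Definition energy (u : state) : R := rsubmx u 0 0.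

(* The quantity whose power -1/2 is Upsilon_u(phi). *)
Definition upsilon_base (u : state) (phi : R) : R :=
  let m := momentum u in let B := magnetic u in
  (phi ^+ 2 * (phi + enorm B ^+ 2) ^+ 2
     - (phi ^+ 2 * enorm m ^+ 2
        + (2 * phi + enorm B ^+ 2) * dot m B ^+ 2))
  / (phi ^+ 2 * (phi + enorm B ^+ 2) ^+ 2).

Definition upsilon (u : state) (phi : R) : R :=
  (Num.sqrt (upsilon_base u phi))^-1.

Definition Ffun (Gamma : R) (u : state) (phi : R) : R :=
  let m := momentum u in let B := magnetic u in
  phi - energy u + enorm B ^+ 2
  - 2^-1 * (dot m B ^+ 2 / phi ^+ 2 + enorm B ^+ 2 / upsilon u phi ^+ 2)
  + (Gamma - 1) / Gamma
    * (density u / upsilon u phi - phi / upsilon u phi ^+ 2).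

(* Upsilon_u(phi), hence F(phi; u), is a real number only where the base of
   the power -1/2 is positive; elsewhere the total functions sqrt and ^-1
   return junk values, so such phi are excluded. *)
Definition positive_root (Gamma : R) (u : state) (phi : R) : Prop :=
  [/\ 0 < phi, 0 < upsilon_base u phi & Ffun Gamma u phi = 0].

(* phihat is the implicit function "the positive root of F(.; u)" on the
   states with D > 0: any positive root is phihat u.  The value of phihat is
   unconstrained where there is no positive root.  States with D <= 0 play no
   role (they lie in neither set below) and may have several roots.
   For Gamma > 2 some F(.; u) has two positive roots, so that no such phihat
   exists; for 1 < Gamma <= 2, F(.; u) is strictly increasing. *)
Definition positive_root_function (Gamma : R) (phihat : state -> R) : Prop :=
  forall u, 0 < density u ->
  forall phi, positive_root Gamma u phi -> phihat u = phi.

Definition pressure (Gamma : R) (phihat : state -> R) (u : state) : R :=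
  let phi := phihat u in
  (Gamma - 1) / (Gamma * upsilon u phi ^+ 2)
  * (phi - density u * upsilon u phi).

Definition velocity (phihat : state -> R) (u : state) : 'rV[R]_3 :=
  let phi := phihat u in let m := momentum u in let B := magnetic u in
  (phi + enorm B ^+ 2)^-1 *: (m + (dot m B / phi) *: B).

(* The second conjunct says that p(u) and v(u) are defined. *)
Definition Gset (Gamma : R) (phihat : state -> R) : set state :=
  [set u | [/\ 0 < density u,
               positive_root Gamma u (phihat u),
               0 < pressure Gamma phihat u
             & 0 < 1 - enorm (velocity phihat u)]].

Definition pm_star (vs Bs : 'rV[R]_3) : R :=
  2^-1 * ((1 - enorm vs ^+ 2) * enorm Bs ^+ 2 + dot vs Bs ^+ 2).

Definition n_star (vs Bs : 'rV[R]_3) : state :=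
  mkstate (- Num.sqrt (1 - enorm vs ^+ 2))
          (- vs)
          (- ((1 - enorm vs ^+ 2) *: Bs) - dot vs Bs *: vs)
          1.

Definition varphi (u : state) (vs Bs : 'rV[R]_3) : R :=
  dot u (n_star vs Bs) + pm_star vs Bs.

Definition Gstar : set state :=
  [set u | 0 < density u
           /\ forall Bs vs : 'rV[R]_3, enorm vs <= 1 -> 0 < varphi u vs Bs].

End RMHD.

Arguments state R : clear implicits.
Arguments Gstar R : clear implicits.

(* Main.v *)
Require Import Defs.
From HB Require Import structures.
From mathcomp Require Import all_boot all_order all_algebra.
From mathcomp Require Import all_classical all_reals.
From mathcomp Require Import ring lra.
From mathcomp Require Import topology normedtype realfun.

(** The pressure is positive iff phihat > D Upsilon, and the velocity is
subluminal wherever Upsilon is defined, so u is in G iff D > 0 and the root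
phi = phihat u of F satisfies D < phi / Upsilon.

Both inclusions come from one identity ([varphiE]).  For every phi > 0 where
Upsilon is defined, with v the velocity computed from phi, kappa the number
(Gamma - 1) / Gamma and s = 1 / Upsilon = sqrt (1 - |v|^2),
varphi(u; vs, Bs) is the sum of
- the term - F(phi; u);
- the fluid part kappa (D s - phi s^2) + phi (1 - v.vs)
  - D sqrt (1 - |vs|^2);
- the magnetic part |(vs - v) x B|^2 / 2 + p_m(vs, B - Bs), which is never
  negative.

From G to G_*: at the root, F vanishes, and the fluid part is positive
([fluid_part_gt0]) by 1 - v.vs >= sqrt (1 - |v|^2) sqrt (1 - |vs|^2) and
1 - v.vs > (1 - |v|^2) / 2, provided that kappa <= 1/2.

From G_* to G: some phi0 satisfies D = phi0 / Upsilon ([pressureless_phi]).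
Taking for vs the velocity at phi0 and Bs = B, the fluid and magnetic parts
vanish, so the linear constraint reads F(phi0; u) < 0.  As F tends to
infinity with phi, it has a root beyond phi0, where the pressure is positive
([exists_root]); this root is phihat u, positive roots being unique.

The condition kappa <= 1/2 means Gamma <= 2.  For Gamma > 2 some F( . ; u) has
two positive roots, so no function phihat is as the theorem assumes
([not_positive_root_function]). *)

Import Order.TTheory GRing.Theory Num.Theory numFieldNormedType.Exports.
Local Open Scope ring_scope.

(** * The Euclidean inner product *)

Section DotProduct.
Context {R : realType} {n : nat}.
Implicit Types (x y z : 'rV[R]_n) (a : R).

Lemma dotC x y : dot x y = dot y x.
Proof. by apply: eq_bigr => i _; rewrite mulrC. Qed.

Lemma dotDl x y z : dot (x + y) z = dot x z + dot y z.
Proof. by rewrite -big_split; apply: eq_bigr => i _; rewrite mxE mulrDl. Qed.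

Lemma dotZl a x y : dot (a *: x) y = a * dot x y.
Proof. by rewrite mulr_sumr; apply: eq_bigr => i _; rewrite mxE mulrA. Qed.

Lemma dotDr x y z : dot x (y + z) = dot x y + dot x z.
Proof. by rewrite !(dotC x) dotDl. Qed.

Lemma dotZr a x y : dot x (a *: y) = a * dot x y.
Proof. by rewrite !(dotC x) dotZl. Qed.

Lemma dotNl x y : dot (- x) y = - dot x y.
Proof. by rewrite -scaleN1r dotZl mulN1r. Qed.

Lemma dotNr x y : dot x (- y) = - dot x y.
Proof. by rewrite -scaleN1r dotZr mulN1r. Qed.

Lemma dot0 x : dot x 0 = 0.
Proof. by rewrite -(scale0r 0) dotZr mul0r. Qed.

Definition dotE := (dotDl, dotDr, dotNl, dotNr, dotZl, dotZr).

Lemma dot_ge0 x : 0 <= dot x x.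
Proof. by apply: sumr_ge0 => i _; rewrite -expr2 sqr_ge0. Qed.

Lemma dot_eq0 x : dot x x = 0 -> x = 0.
Proof.
move=> /eqP; rewrite psumr_eq0 => [/allP x0 | i _]; last by rewrite -expr2 sqr_ge0.
apply/rowP => i; rewrite mxE; apply/eqP.
by have := x0 i (mem_index_enum i); rewrite mulf_eq0 orbb.
Qed.

Lemma cauchy_schwarz x y : dot x y ^+ 2 <= dot x x * dot y y.
Proof.
have [/dot_eq0 -> | yy0] := eqVneq (dot y y) 0.
  by rewrite !dot0 mulr0 expr0n.
have yy_gt0 : 0 < dot y y by rewrite lt_def yy0 dot_ge0.
have := dot_ge0 (dot y y *: x - dot x y *: y).
have -> : dot (dot y y *: x - dot x y *: y) (dot y y *: x - dot x y *: y)
  = dot y y * (dot x x * dot y y - dot x y ^+ 2).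
  by rewrite !dotE (dotC y x); ring.
by rewrite pmulr_rge0 // subr_ge0.
Qed.

Lemma sqr_enorm x : enorm x ^+ 2 = dot x x.
Proof. by rewrite sqr_sqrtr ?dot_ge0. Qed.

Lemma enorm_le1 x : (enorm x <= 1) = (dot x x <= 1).
Proof. by rewrite -sqr_enorm expr_le1 ?sqrtr_ge0. Qed.

Lemma enorm_lt1 x : (enorm x < 1) = (dot x x < 1).
Proof. by rewrite -sqr_enorm expr_lt1 ?sqrtr_ge0. Qed.

(** The reversed Cauchy-Schwarz inequality for the future causal vectors
(1, v) and (1, vs) of Minkowski space. *)
Lemma sqrt_mul_le_dot (v vs : 'rV[R]_n) : dot v v <= 1 -> dot vs vs <= 1 ->
  Num.sqrt (1 - dot v v) * Num.sqrt (1 - dot vs vs) <= 1 - dot v vs.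
Proof.
move=> v1 vs1; have := dot_ge0 (v - vs); rewrite !dotE (dotC vs v).
have := @sqr_sqrtr _ (1 - dot v v); rewrite subr_ge0 => /(_ v1).
have := @sqr_sqrtr _ (1 - dot vs vs); rewrite subr_ge0 => /(_ vs1).
move: (Num.sqrt (1 - dot v v)) (Num.sqrt (1 - dot vs vs)) => s ss.
have := sqr_ge0 (s - ss); rewrite sqrrB; lra.
Qed.

(** With p the pressure, this is what makes p (1 - v.vs) / (1 - |v|^2) exceed
p / 2: the inequality says |v - vs|^2 + (1 - |vs|^2) > 0, and both terms vanish
only if |v| = 1. *)
Lemma half_lt_dot (v vs : 'rV[R]_n) : dot v v < 1 -> dot vs vs <= 1 ->
  2^-1 * (1 - dot v v) < 1 - dot v vs.
Proof.
move=> v1 vs1.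
have t2 : dot v vs ^+ 2 <= dot v v.
  by apply: le_trans (cauchy_schwarz v vs) _; rewrite ler_piMr ?dot_ge0.
have t1 : dot v vs < 1.
  by case: (ltrP (dot v vs) 1) => // t1; have := le_lt_trans t2 v1; nra.
nra.
Qed.

(** This is the fluid (field-free) part of varphi.  With A = 1 - v.vs and
ss = sqrt (1 - |vs|^2) it is a combination of A - s ss >= 0 and
A - kappa s^2 > 0.  The weights are the two parts of phi: D / s, due to the rest
mass, and phi - D / s, due to the thermal energy and positive because the
pressure is. *)
Lemma fluid_part_gt0 (kappa D phi : R) (v vs : 'rV[R]_n)
    (s := Num.sqrt (1 - dot v v)) :
  kappa <= 2^-1 -> 0 < D -> D < phi * s -> dot v v < 1 -> dot vs vs <= 1 ->
  0 < kappa * (D * s - phi * s ^+ 2) + phi * (1 - dot v vs)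
      - D * Num.sqrt (1 - dot vs vs).
Proof.
move=> kappa2 D0 Dphi v1 vs1.
have s2 : s ^+ 2 = 1 - dot v v by rewrite sqr_sqrtr // subr_ge0 ltW.
have s0 : 0 < s by rewrite sqrtr_gt0 subr_gt0.
have := sqrt_mul_le_dot _ _ (ltW v1) vs1; have := half_lt_dot _ _ v1 vs1;
  rewrite -/s -s2.
set A := 1 - dot v vs; set ss := Num.sqrt (1 - dot vs vs) => A1 A2.
have -> : kappa * (D * s - phi * s ^+ 2) + phi * A - D * ss
        = D / s * (A - s * ss) + (phi - D / s) * (A - kappa * s ^+ 2).
  by field; lra.
apply: ltr_wpDl; first by apply: mulr_ge0; [rewrite divr_ge0 // ltW | rewrite subr_ge0].
rewrite mulr_gt0 // subr_gt0 ?ltr_pdivrMr //.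
by apply: le_lt_trans A1; rewrite ler_wpM2r // sqr_ge0.
Qed.

Lemma affine_fun_dot (w : 'rV[R]_n) (c : R) : affine_fun (fun x => dot x w + c).
Proof.
have lin : scalar (fun x => dot x w) by move=> a x y; rewrite dotDl dotZl.
pose l : {scalar 'rV[R]_n} :=
  HB.pack (fun x => dot x w) (GRing.isLinear.Build _ _ _ _ (fun x => dot x w) lin).
by exists l, c.
Qed.

End DotProduct.

Lemma dot_row_mx {R : realType} {p q : nat} (x : 'rV[R]_(p + q)) y z :
  dot x (row_mx y z) = dot (lsubmx x) y + dot (rsubmx x) z.
Proof.
rewrite /dot big_split_ord /=.
by congr (_ + _); apply: eq_bigr => i _; rewrite ?row_mxEl ?row_mxEr mxE.
Qed.

(** * Continuity tools *)

Section Continuity.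
Context {R : realType}.

Lemma intermediate_value (f : R -> R) (a b c : R) : a <= b ->
  (forall x, a <= x -> {for x, continuous f}) -> f a <= c -> c <= f b ->
  exists2 x, a <= x & f x = c.
Proof.
move=> ab cf fac cfb; have [||x] := @IVT R f a b c ab.
- apply: continuous_in_subspaceT => x /set_mem /=.
  by rewrite in_itv /= => /andP[ax _]; apply: cf.
- by rewrite ge_min le_max fac cfb orbT.
- by rewrite in_itv /= => /andP[ax _] fx; exists x.
Qed.

Lemma continuous_sqr (f : R -> R) (x : R) : {for x, continuous f} ->
  {for x, continuous (fun y => f y ^+ 2)}.
Proof. by move=> cf; apply: continuousM. Qed.

End Continuity.

(** * States in terms of the primitive variables *)

Section States.
Context {R : realType}.
Implicit Types (u : state R) (m B v : 'rV[R]_3) (D E phi : R).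

Lemma dot_mkstate u D m B E :
  dot u (mkstate D m B E) =
  density u * D + dot (momentum u) m + dot (magnetic u) B + energy u * E.
Proof.
rewrite /mkstate !dot_row_mx /density /energy /momentum /magnetic.
by rewrite {1 4}/dot !big_ord1 !mxE !mulr1n.
Qed.

Lemma mkstateK D m B E :
  [/\ density (mkstate D m B E) = D, momentum (mkstate D m B E) = m,
      magnetic (mkstate D m B E) = B & energy (mkstate D m B E) = E].
Proof.
rewrite /density /momentum /magnetic /energy /mkstate.
by rewrite !(row_mxKl, row_mxKr) !mxE !mulr1n.
Qed.

Lemma upsilonV u phi : (upsilon u phi)^-1 = Num.sqrt (upsilon_base u phi).
Proof. exact: invrK. Qed.

(** Below, [velocity (fun=> phi) u] is the velocity that u would have if its
value of [rho h gamma^2] were phi. *)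

Lemma velocity_dot_magnetic u phi : 0 < phi ->
  dot (velocity (fun=> phi) u) (magnetic u) = dot (momentum u) (magnetic u) / phi.
Proof.
move=> phi0; rewrite /velocity sqr_enorm !dotE.
have := dot_ge0 (magnetic u); set b := dot (magnetic u) _ => b0.
field; lra.
Qed.

Lemma momentumE u phi (v := velocity (fun=> phi) u) (B := magnetic u) : 0 < phi ->
  momentum u = (phi + dot B B) *: v - dot v B *: B.
Proof.
move=> phi0; rewrite velocity_dot_magnetic // /v /velocity sqr_enorm scalerA.
have b0 := dot_ge0 B; rewrite mulfV ?scale1r ?addrK //.
by rewrite gt_eqF // ltr_pwDl.
Qed.

(** Upsilon is the Lorentz factor of the velocity at phi; in particular that
velocity is subluminal as soon as Upsilon is defined. *)
Lemma upsilon_baseE u phi (v := velocity (fun=> phi) u) : 0 < phi ->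
  upsilon_base u phi = 1 - dot v v.
Proof.
move=> phi0; rewrite /upsilon_base /v /velocity !sqr_enorm !dotE.
rewrite (dotC (magnetic u) (momentum u)).
have := dot_ge0 (magnetic u); set b := dot (magnetic u) _ => b0.
field; lra.
Qed.

(** F is the residual of the energy equation
E = rho h gamma^2 + |B|^2 - p_m - p: phi stands for rho h gamma^2, pm_star v B
is p_m, and the last term is minus the pressure that the equation of state
gives. *)
Lemma FfunE (Gamma : R) u phi (v := velocity (fun=> phi) u) (B := magnetic u)
    (s := Num.sqrt (upsilon_base u phi)) :
  0 < phi -> 0 < upsilon_base u phi ->
  Ffun Gamma u phi = phi - energy u + dot B B - pm_star v B
    + (Gamma - 1) / Gamma * (density u * s - phi * s ^+ 2).
Proof.
move=> phi0 W0; rewrite /Ffun -!exprVn upsilonV -/s /pm_star !sqr_enorm.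
rewrite /v velocity_dot_magnetic // -/v -upsilon_baseE // sqr_sqrtr ?ltW //.
rewrite exprMn exprVn; ring.
Qed.

Lemma pressure_gt0 (Gamma : R) (phihat : state R -> R) u (phi := phihat u) :
  1 < Gamma -> 0 < upsilon_base u phi ->
  (0 < pressure Gamma phihat u)
  = (density u < phi * Num.sqrt (upsilon_base u phi)).
Proof.
move=> G1 W0; rewrite /pressure -/phi.
have s0 : 0 < Num.sqrt (upsilon_base u phi) by rewrite sqrtr_gt0.
have y0 : 0 < upsilon u phi by rewrite invr_gt0.
rewrite pmulr_rgt0; last by rewrite divr_gt0 ?mulr_gt0 ?exprn_gt0 //; lra.
by rewrite subr_gt0 -ltr_pdivlMr // upsilonV.
Qed.

(** The identity behind both inclusions.  The first term vanishes at the root;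
the second is the fluid part.  The last is the magnetic part: up to terms
that F absorbs, B enters varphi through the quadratic form pm_star vs
evaluated at B - Bs, and completing the square in v leaves the Gram
determinant of vs - v and B, that is, the squared norm of their cross
product. *)
Lemma varphiE (Gamma : R) u phi (v := velocity (fun=> phi) u) (B := magnetic u)
    (s := Num.sqrt (upsilon_base u phi)) (vs Bs : 'rV[R]_3) :
  0 < phi -> 0 < upsilon_base u phi ->
  varphi u vs Bs =
    - Ffun Gamma u phi
    + ((Gamma - 1) / Gamma * (density u * s - phi * s ^+ 2)
       + phi * (1 - dot v vs) - density u * Num.sqrt (1 - dot vs vs))
    + (2^-1 * (dot (vs - v) (vs - v) * dot B B - dot (vs - v) B ^+ 2)
       + pm_star vs (B - Bs)).
Proof.
move=> phi0 W0; rewrite /varphi /n_star dot_mkstate (momentumE u phi) //.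
rewrite FfunE // -/v -/B -/s /pm_star !sqr_enorm.
clearbody v; rewrite !dotE.
rewrite (dotC vs v) (dotC Bs B) (dotC vs B).
by move: ((Gamma - 1) / Gamma) => kappa; field.
Qed.

Lemma pm_star_ge0 (vs Bs : 'rV[R]_3) : enorm vs <= 1 -> 0 <= pm_star vs Bs.
Proof.
rewrite enorm_le1 /pm_star !sqr_enorm => vs1.
by rewrite mulr_ge0 ?invr_ge0 // addr_ge0 ?sqr_ge0 // mulr_ge0 ?dot_ge0 // subr_ge0.
Qed.

(** * A state with positive pressure satisfies the linear constraints *)

Lemma varphi_gt0 (Gamma : R) u phi (vs Bs : 'rV[R]_3) :
  1 < Gamma -> Gamma <= 2 -> 0 < density u -> positive_root Gamma u phi ->
  density u < phi * Num.sqrt (upsilon_base u phi) -> enorm vs <= 1 ->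
  0 < varphi u vs Bs.
Proof.
move=> G1 G2 D0 [phi0 W0 F0] p0 vs1.
rewrite (varphiE Gamma u phi) // F0 oppr0 add0r.
have vs1' : dot vs vs <= 1 by rewrite -enorm_le1.
move: W0 p0; rewrite upsilon_baseE // subr_gt0 => v1 p0.
apply: ltr_wpDr.
  apply: addr_ge0; last exact: pm_star_ge0.
  by rewrite mulr_ge0 ?invr_ge0 // subr_ge0 cauchy_schwarz.
apply: fluid_part_gt0 => //.
(* Here 2^-1 bounds (Gamma - 1) / Gamma because Gamma <= 2. *)
by rewrite ler_pdivrMr; lra.
Qed.

(** * The implicit function phihat exists only for Gamma <= 2 *)

(** For B = 0 and |m| = 1, the equation F = 0 reads
h phi + kappa D s phi = E, where h phi = (1 - kappa) phi + kappa / phi and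
s phi = sqrt (1 - phi^-2).  When kappa > 1/2, h decreases just above phi = 1;
h x > h y for x < y iff x y < kappa / (1 - kappa) = Gamma - 1.  For two such
points D > 0 can be chosen to make the left-hand sides at x and y agree, and
E is then their common value. *)
Lemma not_positive_root_function (Gamma : R) (phihat : state R -> R) :
  2 < Gamma -> ~ positive_root_function Gamma phihat.
Proof.
move=> G2 uniq_root.
(* This e makes x y = 1 + 3 e + 2 e^2 <= 1 + 5 e less than Gamma - 1. *)
pose e := Num.min 1 ((Gamma - 2) / 8).
have e0 : 0 < e by rewrite lt_min; lra.
have e1 : e <= 1 by rewrite ge_min lexx.
have eG : e <= (Gamma - 2) / 8 by rewrite ge_min lexx orbT.
pose x := 1 + e; pose y := 1 + 2 * e.
have xy : x * y < Gamma - 1 by rewrite /x /y; nra.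
pose kappa := (Gamma - 1) / Gamma.
have kappa0 : 0 < kappa by rewrite divr_gt0; lra.
have kappaE : 1 - kappa = Gamma^-1 by rewrite /kappa; field; lra.
pose s (z : R) := Num.sqrt (1 - z^-1 ^+ 2).
have W0 (z : R) : 1 < z -> 0 < 1 - z^-1 ^+ 2.
  by move=> z1; rewrite subr_gt0 exprVn invf_lt1 ?exprn_gt0 ?exprn_egt1 //; lra.
have x1 : 1 < x by rewrite /x; lra.
have y1 : 1 < y by rewrite /y; lra.
have sxy : s x < s y.
  rewrite ltr_sqrt ?W0 // ltrD2l ltrN2 ltr_pXn2r ?nnegrE ?invr_ge0 //; try lra.
  by rewrite ltf_pV2 ?posrE /x /y; lra.
pose h z := (1 - kappa) * z + kappa / z.
pose D := (h x - h y) / (kappa * (s y - s x)).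
have D0 : 0 < D.
  apply: divr_gt0; last by apply: mulr_gt0; [exact: kappa0 | rewrite subr_gt0].
  rewrite subr_gt0.
  have -> : h x = h y + (y - x) * (kappa / (x * y) - (1 - kappa)).
    by rewrite /h; field; lra.
  rewrite ltrDl mulr_gt0 //; first by rewrite /x /y; lra.
  have xy0 : 0 < x * y by rewrite mulr_gt0; lra.
  have Gamma0 : 0 < Gamma^-1 by rewrite invr_gt0; lra.
  by rewrite kappaE subr_gt0 ltr_pdivlMr // mulrC /kappa ltr_pM2r.
pose m : 'rV[R]_3 := delta_mx 0 0.
have m1 : dot m m = 1.
  rewrite /dot (bigD1 0) //= big1 => [|i /negbTE i0].
    by rewrite !mxE eqxx mulr1 addr0.
  by rewrite !mxE i0 andbF mulr0.
pose E := h x + kappa * D * s x.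
have hE z : z = x \/ z = y -> h z + kappa * D * s z = E.
  by case=> -> //; rewrite /E /D; field; lra.
pose u := mkstate D m 0 E.
have [uD um uB uE] := mkstateK D m 0 E.
have root z : z = x \/ z = y -> positive_root Gamma u z.
  move=> zxy; have z1 : 1 < z by case: zxy => ->.
  have z0 : 0 < z by lra.
  have vE : velocity (fun=> z) u = z^-1 *: m.
    by rewrite /velocity um uB sqr_enorm scaler0 dot0 !addr0.
  have base : upsilon_base u z = 1 - z^-1 ^+ 2.
    by rewrite upsilon_baseE // vE !dotE m1 mulr1.
  split=> //; first by rewrite base W0.
  have sz2 : s z ^+ 2 = 1 - z^-1 ^+ 2 by rewrite sqr_sqrtr ?ltW ?W0.
  rewrite FfunE // ?base ?W0 // /pm_star vE uB uE uD !sqr_enorm.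
  rewrite !dot0 -(hE z zxy) -/kappa -/(s z) sz2 expr0n /h /=.
  by field; lra.
have u0 : 0 < density u by rewrite uD.
have := uniq_root u u0 x (root x (or_introl erefl)).
rewrite (uniq_root u u0 y (root y (or_intror erefl))) /x /y; lra.
Qed.

(** * The linear constraints force a root with positive pressure *)

(** In this form every factor of the subtracted term is a nonincreasing
function of phi, so that the base is nondecreasing. *)
Lemma upsilon_base_inv u phi (x := phi^-1)
    (y := (phi + dot (magnetic u) (magnetic u))^-1) : 0 < phi ->
  upsilon_base u phi = 1 -
    (dot (momentum u) (momentum u) * (y * y)
     + dot (momentum u) (magnetic u) ^+ 2 * (x * y * (x + y))).
Proof.
move=> phi0; rewrite /upsilon_base /x /y !sqr_enorm.
have := dot_ge0 (magnetic u); set b := dot (magnetic u) _ => b0.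
field; lra.
Qed.

Lemma upsilon_base_le1 u phi : 0 < phi -> upsilon_base u phi <= 1.
Proof. by move=> phi0; rewrite upsilon_baseE // gerBl dot_ge0. Qed.

Lemma upsilon_base_homo u phi1 phi2 : 0 < phi1 -> phi1 <= phi2 ->
  upsilon_base u phi1 <= upsilon_base u phi2.
Proof.
move=> phi1_gt0 le12; have phi2_gt0 := lt_le_trans phi1_gt0 le12.
rewrite !upsilon_base_inv // lerD2l lerN2.
have := dot_ge0 (magnetic u); set b := dot (magnetic u) _ => b0.
have x0 : 0 <= phi2^-1 by rewrite invr_ge0 ltW.
have y0 : 0 <= (phi2 + b)^-1 by rewrite invr_ge0; lra.
have x12 : phi2^-1 <= phi1^-1 by rewrite lef_pV2.
have y12 : (phi2 + b)^-1 <= (phi1 + b)^-1 by rewrite lef_pV2 ?posrE; lra.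
by rewrite lerD // ler_wpM2l ?dot_ge0 ?sqr_ge0 // !ler_pM ?mulr_ge0 ?addr_ge0 ?lerD.
Qed.

Lemma continuous_upsilon_base u phi : 0 < phi ->
  {for phi, continuous (upsilon_base u)}.
Proof.
move=> phi0.
have cst (c : R) : {for phi, continuous (fun=> c)} by apply: cst_continuous.
have cid : {for phi, continuous (fun x : R => x)} by apply: cvg_id.
have b0 := sqr_ge0 (enorm (magnetic u)).
have cb : {for phi, continuous (fun x : R => x + enorm (magnetic u) ^+ 2)}.
  exact: continuousD.
apply: continuousM.
  apply: continuousB; first by apply: continuousM; apply: continuous_sqr.
  apply: continuousD; first by apply: continuousM => //; apply: continuous_sqr.
  by apply: continuousM => //; apply: continuousD => //; apply: continuousM.
apply: continuousV; last by apply: continuousM; apply: continuous_sqr.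
by rewrite mulf_neq0 // expf_neq0 // gt_eqF //; lra.
Qed.

Lemma continuous_Ffun (Gamma : R) u phi : 0 < phi -> 0 < upsilon_base u phi ->
  {for phi, continuous (Ffun Gamma u)}.
Proof.
move=> phi0 W0.
have cst (c : R) : {for phi, continuous (fun=> c)} by apply: cst_continuous.
have cid : {for phi, continuous (fun x : R => x)} by apply: cvg_id.
have s0 : Num.sqrt (upsilon_base u phi) != 0 by rewrite gt_eqF ?sqrtr_gt0.
have u0 : upsilon u phi != 0 by rewrite invr_eq0.
have cu : {for phi, continuous (upsilon u)}.
  apply: continuousV => //; apply: continuous_comp.
    exact: continuous_upsilon_base.
  exact: sqrt_continuous.
have phi_neq0 : phi != 0 by rewrite gt_eqF.
have cdiv (f g : R -> R) : g phi != 0 -> {for phi, continuous f} ->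
    {for phi, continuous g} -> {for phi, continuous (fun x => f x / g x)}.
  by move=> g0 cf cg; apply: continuousM => //; apply: continuousV.
apply: continuousD.
  apply: continuousB; first by apply: continuousD => //; apply: continuousB.
  apply: continuousM => //; apply: continuousD; apply: cdiv => //;
    try exact: continuous_sqr.
    by rewrite expf_neq0.
  by rewrite expf_neq0.
apply: continuousM => //; apply: continuousB; first exact: cdiv.
by apply: cdiv => //; [rewrite expf_neq0 | exact: continuous_sqr].
Qed.

(** At D = phi / Upsilon the equation of state gives pressure 0.  Such a phi
exists because phi^2 times the base is at most D^2 at phi = D, the base
being at most 1, and grows like phi^2. *)
Lemma pressureless_phi u : 0 < density u ->
  exists phi, [/\ 0 < phi, 0 < upsilon_base u phi
    & density u = phi * Num.sqrt (upsilon_base u phi)].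
Proof.
set D := density u => D0.
set m2 := dot (momentum u) (momentum u); set c := dot (momentum u) (magnetic u).
have m20 : 0 <= m2 by apply: dot_ge0.
have c20 := sqr_ge0 c.
have D20 := sqr_ge0 D.
pose M := D + 1 + m2 + 2 * c ^+ 2 + D ^+ 2.
have M1 : 1 <= M by rewrite /M; lra.
have M0 : 0 < M by lra.
pose f phi := phi ^+ 2 * upsilon_base u phi.
have fD : f D <= D ^+ 2.
  by rewrite /f ler_piMr ?upsilon_base_le1.
(* M is so large that M^2 >= M exceeds D^2 plus the bound |m|^2 + 2 c^2 on the
   subtracted terms, c being m.B. *)
have fM : D ^+ 2 <= f M.
  have := dot_ge0 (magnetic u).
  rewrite /f upsilon_base_inv // -/m2 -/c; set b := dot _ _ => b0.
  have x0 : 0 <= M^-1 by rewrite invr_ge0 ltW.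
  have x1 : M^-1 <= 1 by rewrite invf_le1.
  have y0 : 0 <= (M + b)^-1 by rewrite invr_ge0; lra.
  have yx : (M + b)^-1 <= M^-1 by rewrite lef_pV2 ?posrE; lra.
  have Mx : M * M^-1 = 1 by rewrite mulfV ?gt_eqF.
  move: (M^-1) ((M + b)^-1) x0 x1 y0 yx Mx => x y x0 x1 y0 yx Mx.
  have yy : y * y <= x * x by rewrite ler_pM.
  have xyy : x * y * (x + y) <= x * x * 2.
    by rewrite ler_pM ?mulr_ge0 ?addr_ge0 ?ler_wpM2l; lra.
  have bound : m2 * (y * y) + c ^+ 2 * (x * y * (x + y))
      <= m2 * (x * x) + c ^+ 2 * (x * x * 2).
    by rewrite lerD // ler_wpM2l.
  apply: (@le_trans _ _ (M ^+ 2 * (1 - (m2 * (x * x) + c ^+ 2 * (x * x * 2))))).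
    have -> : M ^+ 2 * (1 - (m2 * (x * x) + c ^+ 2 * (x * x * 2)))
        = M ^+ 2 - (M * x) ^+ 2 * (m2 + 2 * c ^+ 2) by ring.
    have MM : M <= M ^+ 2 by rewrite expr2 ler_peMl // ltW.
    by rewrite Mx expr1n mul1r; move: MM; rewrite {1}/M; lra.
  by rewrite ler_wpM2l ?sqr_ge0 // lerD2l lerN2.
have [phi Dphi fphi] : exists2 phi, D <= phi & f phi = D ^+ 2.
  apply: (intermediate_value f D M) => //; first by rewrite /M; lra.
  move=> phi Dphi; have phi0 := lt_le_trans D0 Dphi.
  apply: continuousM; last exact: continuous_upsilon_base.
  by apply: continuousM; apply: cvg_id.
have phi0 := lt_le_trans D0 Dphi.
have W0 : 0 < upsilon_base u phi.
  by rewrite -(pmulr_rgt0 _ (exprn_gt0 2 phi0)) -/(f phi) fphi exprn_gt0.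
exists phi; split => //; apply/eqP.
rewrite -(@eqrXn2 _ 2) ?mulr_ge0 ?sqrtr_ge0 ?ltW //.
by rewrite exprMn sqr_sqrtr ?ltW // -/(f phi) fphi.
Qed.

Lemma Ffun_lower_bound (Gamma : R) u phi :
  1 < Gamma -> 0 < density u -> 1 <= phi -> 0 < upsilon_base u phi ->
  phi / Gamma - energy u - 2^-1 * dot (momentum u) (magnetic u) ^+ 2
  <= Ffun Gamma u phi.
Proof.
move=> G1 D0 phi1 W0; have phi0 : 0 < phi by lra.
have W1 := upsilon_base_le1 u phi phi0.
rewrite FfunE // /pm_star !sqr_enorm -upsilon_baseE // velocity_dot_magnetic //.
have s20 : Num.sqrt (upsilon_base u phi) ^+ 2 = upsilon_base u phi.
  by rewrite sqr_sqrtr // ltW.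
rewrite s20; have s0 := sqrtr_ge0 (upsilon_base u phi).
move: (upsilon_base u phi) (Num.sqrt _) W0 W1 s0 => W s W0 W1 s0.
have := dot_ge0 (magnetic u); set b := dot (magnetic u) _ => b0.
set c := dot _ _; set D := density u.
have x0 : 0 <= phi^-1 by rewrite invr_ge0 ltW.
have x1 : phi^-1 <= 1 by rewrite invf_le1.
have cx : (c / phi) ^+ 2 <= c ^+ 2.
  by rewrite exprMn ler_piMr ?sqr_ge0 // expr_le1.
have Wb : W * b <= b by rewrite ler_piMl // ltW.
have kappaE : (Gamma - 1) / Gamma = 1 - Gamma^-1 by field; lra.
have kappa0 : 0 <= (Gamma - 1) / Gamma by rewrite divr_ge0; lra.
have kD : 0 <= (Gamma - 1) / Gamma * (D * s).
  by rewrite mulr_ge0 // mulr_ge0 // ltW.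
have kW : (Gamma - 1) / Gamma * (phi * W) <= (Gamma - 1) / Gamma * phi.
  by rewrite ler_wpM2l // ler_piMr // ltW.
move: kD kW; rewrite kappaE !mulrBr !mulrBl !mul1r; lra.
Qed.

(** At the pressureless phi0, with vs its velocity and Bs = B, the fluid and
magnetic parts of varphi vanish, so that varphi = - F: the constraint says
F phi0 < 0.  Since F grows like phi / Gamma it vanishes at some phi > phi0,
and the pressure is positive there because phi / Upsilon is increasing. *)
Lemma exists_root (Gamma : R) u : 1 < Gamma -> Gstar R u ->
  exists2 phi, positive_root Gamma u phi
    & density u < phi * Num.sqrt (upsilon_base u phi).
Proof.
move=> G1 [D0 pos].
have [phi0 [phi0_gt0 W0 D_phi0]] := pressureless_phi u D0.
have F0 : Ffun Gamma u phi0 < 0.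
  have := pos (magnetic u) (velocity (fun=> phi0) u).
  rewrite enorm_le1 (varphiE Gamma u phi0) //.
  have : dot (velocity (fun=> phi0) u) (velocity (fun=> phi0) u)
      = 1 - upsilon_base u phi0 by rewrite upsilon_baseE // subKr.
  move: (velocity _ u) => v vv.
  rewrite !subrr /pm_star !sqr_enorm !dot0 (dotC 0) dot0 vv subKr.
  have s2 : Num.sqrt (upsilon_base u phi0) ^+ 2 = upsilon_base u phi0.
    by rewrite sqr_sqrtr // ltW.
  have Ds : density u * Num.sqrt (upsilon_base u phi0)
      = phi0 * upsilon_base u phi0 by rewrite D_phi0 -mulrA -expr2 s2.
  rewrite Ds s2; lra.
pose M := phi0 + 1 +
  Gamma * (`|energy u| + 2^-1 * dot (momentum u) (magnetic u) ^+ 2).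
have M_ge : 0 <= Gamma * (`|energy u| + 2^-1 * dot (momentum u) (magnetic u) ^+ 2).
  have c0 := sqr_ge0 (dot (momentum u) (magnetic u)).
  have E0 := normr_ge0 (energy u).
  by apply: mulr_ge0; lra.
have phi0M : phi0 <= M by rewrite /M; lra.
have W_gt0 phi : phi0 <= phi -> 0 < upsilon_base u phi.
  by move=> le_phi; apply: lt_le_trans W0 _; apply: upsilon_base_homo.
have FM : 0 <= Ffun Gamma u M.
  apply: le_trans (Ffun_lower_bound Gamma u M G1 D0 _ (W_gt0 M phi0M)); last first.
    by rewrite /M; lra.
  have -> : M / Gamma = (phi0 + 1) / Gamma
      + (`|energy u| + 2^-1 * dot (momentum u) (magnetic u) ^+ 2).
    by rewrite /M; field; lra.
  have : 0 <= (phi0 + 1) / Gamma by rewrite divr_ge0; lra.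
  by have := ler_norm (energy u); lra.
have [phi phi0_le Fphi] : exists2 phi, phi0 <= phi & Ffun Gamma u phi = 0.
  apply: (intermediate_value _ phi0 M) => //; last exact: ltW.
  move=> phi le_phi; apply: continuous_Ffun; last exact: W_gt0.
  exact: lt_le_trans le_phi.
have phi0_lt : phi0 < phi.
  by rewrite lt_neqAle phi0_le andbT; apply/eqP => e; move: F0; rewrite e Fphi ltxx.
exists phi; first by split; rewrite ?W_gt0 //; exact: lt_trans phi0_lt.
have phi_gt0 := lt_trans phi0_gt0 phi0_lt.
apply: (@lt_le_trans _ _ (phi * Num.sqrt (upsilon_base u phi0))).
  by rewrite D_phi0 ltr_pM2r ?sqrtr_gt0.
by rewrite ler_pM2l // ler_wsqrtr // upsilon_base_homo.
Qed.

End States.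

(** * The GQL representation *)

Theorem theorem4p13 (R : realType) (Gamma : R) (hGamma : 1 < Gamma)
    (phihat : state R -> R) (hphihat : positive_root_function Gamma phihat) :
  [/\ Gset Gamma phihat = Gstar R,
      affine_fun (fun u : state R => density u)
    & forall vs Bs : 'rV[R]_3, enorm vs <= 1 ->
        affine_fun (fun u : state R => varphi u vs Bs)].
Proof.
split; last by move=> vs Bs _; apply: affine_fun_dot.
- have Gamma2 : Gamma <= 2.
    by case: (lerP Gamma 2) => // /not_positive_root_function /(_ hphihat).
  apply/seteqP; split=> u.
  + move=> [D0 root p0 _]; split=> // Bs vs vs1.
    have [_ W0 _] := root.
    apply: (varphi_gt0 Gamma u (phihat u)) => //.
    by rewrite -(pressure_gt0 Gamma).
  + move=> Gu; have [phi root p0] := exists_root Gamma u hGamma Gu.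
    have [D0 _] := Gu; have phiE := hphihat u D0 phi root.
    have [phi0 W0 _] := root.
    split; [exact: D0 | by rewrite phiE | | ].
      by rewrite (pressure_gt0 Gamma phihat u hGamma) phiE.
    rewrite subr_gt0 enorm_lt1 -subr_gt0.
    move: (upsilon_baseE u phi phi0); rewrite /velocity phiE => <-.
    exact: W0.
- have [l [c lE]] := affine_fun_dot (mkstate (1 : R) 0 0 0) 0.
  exists l, c => u; rewrite -lE dot_mkstate !dot0 !mulr0 mulr1 !addr0 //.
Qed.
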